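(* Let $G=(V,E)$ be a finite connected directed graph with no loops and such that for distinct vertices $a,b$ at most one of $(a,b),(b,a)$ lies in $E$. Let $f$ be a real function on $V$ with $\sum_{a\in V}f(a)=0$, and let $B$ be a minimizer of $\|A\|^2$ subject to $\nabla\cdot A=f$; set $D(A)=\xi(A)-\xi(B)$. Let $T\subseteq E$ form a spanning tree of the underlying undirected graph with $E\setminus T\ne\emptyset$, $\tau=\sum_{e\in E\setminus T}\|C_e\|^2$. For a real function $A$ on $E$ with $\nabla\cdot A=f$, let $A'=A+\alpha^*C$ where $C=C_e$ is chosen at random from $\{C_e:e\in E\setminus T\}$ with probability $\|C_e\|^2/\tau$ and $\alpha^*=-(A,C)/\|C\|^2$. Then the expected convergence rate of the energy is bounded by $1-\frac1\tau$, namely $$\mathbb{E}\bigl(D(A')\bigr)\le\Bigl(1-\frac1\tau\Bigr)D(A).$$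
   Context: For real functions on a finite set, $(f,g)=\sum f(x)g(x)$ and $\|f\|^2=(f,f)$; the energy is $\xi(A)=\|A\|^2$. The divergence of a function $A$ on $E$ is $\nabla\cdot A(a)=\sum_{(b,a)\in E}A(b,a)-\sum_{(a,b)\in E}A(a,b)$. For $e\in E\setminus T$, $C_e$ is the tree cycle function: for the unique cycle $(a_1,\dots,a_k,a_1)$ of the underlying undirected graph formed by $e$ and edges of $T$, traversed so that $e$ is traversed in its own direction, $C_e(a_i,a_{i+1})=1$ if $(a_i,a_{i+1})\in E$, $C_e(a_{i+1},a_i)=-1$ if $(a_{i+1},a_i)\in E$, and $0$ on all other edges. *)

(* Defs.v *)
From HB Require Import structures.
From mathcomp Require Import classical_sets reals.
From mathcomp Require Import all_boot all_order all_algebra.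

Set Implicit Arguments.
Unset Strict Implicit.
Unset Printing Implicit Defensive.

Import Order.TTheory GRing.Theory Num.Theory.
Local Open Scope ring_scope.

Section InnerProduct.
Variables (R : realType) (I : finType).
Implicit Types f g : {ffun I -> R}.

Definition dotf f g : R := \sum_x f x * g x.
Definition sqnorm f : R := dotf f f.

Definition expectation (p X : I -> R) : R := \sum_i p i * X i.

End InnerProduct.

Section Digraph.
Variables (V : finType) (E : {set V * V}).

Definition edge : Type := {g : V * V | g \in E}.
HB.instance Definition _ := SubFinite.on edge.

Implicit Types (S T : {set edge}) (e g : edge) (c : seq V) (a b : V).

Definition src g : V := (val g).1.
Definition tgt g : V := (val g).2.

Definition loopless : Prop := forall a, (a, a) \notin E.
Definition antiparallel_free : Prop :=
  forall a b, a != b -> ~~ (((a, b) \in E) && ((b, a) \in E)).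

(* adjacency in the undirected graph on V underlying the edge set S *)
Definition adj S : rel V := fun a b =>
  [exists g in S, (val g == (a, b)) || (val g == (b, a))].

Definition undirected_connected S : Prop := forall a b, connect (adj S) a b.

(* The bound on the size discards [:: a; b], which [ucycle] accepts and which
   uses the same undirected edge twice. *)
Definition undirected_cycle S c : Prop := (2 < size c)%N /\ ucycle (adj S) c.

Definition spanning_tree T : Prop :=
  undirected_connected T /\ forall c, ~ undirected_cycle T c.

(* (a, b) is one of the steps (a_i, a_(i+1)), indices modulo size c *)
Definition step c a b : bool := (a \in c) && (next c a == b).

Definition is_tree_cycle T e c : Prop :=
  undirected_cycle (e |: T) c /\ step c (src e) (tgt e).

(* When T is a spanning tree and e \notin T, such a cycle exists and is unique
   up to rotation, and [step] is invariant under rotation; the default value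
   [::] is then irrelevant. *)
Definition tree_cycle T e : seq V := xget [::] (is_tree_cycle T e).

Section Functions.
Variable R : realType.
Implicit Types (A B C : {ffun edge -> R}) (f : {ffun V -> R}).

Definition energy A : R := sqnorm A.

Definition divergence A : {ffun V -> R} :=
  [ffun a => \sum_(g | tgt g == a) A g - \sum_(g | src g == a) A g].

Definition energy_minimizer f B : Prop :=
  divergence B = f /\ forall A, divergence A = f -> energy B <= energy A.

Definition energy_gap B A : R := energy A - energy B.

Definition cycle_function c : {ffun edge -> R} :=
  [ffun g => if step c (src g) (tgt g) then 1
             else if step c (tgt g) (src g) then -1 else 0].

Definition tree_cycle_function T e : {ffun edge -> R} :=
  cycle_function (tree_cycle T e).

Definition tau T : R := \sum_(e | e \notin T) sqnorm (tree_cycle_function T e).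

(* The functions C_e, e \notin T, are pairwise distinct, since C_e e = 1 and
   C_e g = 0 for every other g \notin T; hence choosing C among them amounts
   to choosing e. *)
Definition cycle_prob T e : R :=
  if e \notin T then sqnorm (tree_cycle_function T e) / tau T else 0.

Definition alpha_star A C : R := - dotf A C / sqnorm C.

Definition cycle_update A C : {ffun edge -> R} :=
  [ffun g => A g + alpha_star A C * C g].

End Functions.
End Digraph.

Arguments tau {V E} R T.
Arguments cycle_prob {V E} R T e.
Arguments tree_cycle_function {V E} R T e.

(* Main.v *)
(* X = A - B has zero divergence, and minimality makes B orthogonal to every
   such function, so D(A) = |X|^2 and the update along C lowers D by
   (X, C)^2 / |C|^2. Averaging with weights |C_e|^2 / tau lowers D by
   (1 / tau) \sum_(e \notin T) (X, C_e)^2. That sum is at least |X|^2: since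
   C_e g = [g = e] for g outside T and a divergence-free function supported on T
   vanishes, X = \sum_(e \notin T) X(e) C_e, hence
   2 |X|^2 = \sum 2 X(e) (X, C_e) <= |X|^2 + \sum (X, C_e)^2. *)
Require Import Defs.
From mathcomp Require Import classical_sets reals.
From mathcomp Require Import all_boot all_order all_algebra.
From mathcomp Require Import ring lra.

Set Implicit Arguments.
Unset Strict Implicit.
Unset Printing Implicit Defensive.

Import Order.TTheory GRing.Theory Num.Theory.
Local Open Scope ring_scope.

(** * The squared norm along a line of functions *)

Section Energy.
Variables (R : realType) (I : finType).
Implicit Types A B C : {ffun I -> R}.

(** The one linear combination needed: [cycle_update A C] is convertible to
    [line A C (alpha_star A C)], and [A - B] is [line A B (-1)]. *)
Definition line A C (t : R) : {ffun I -> R} := [ffun g => A g + t * C g].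

Lemma sqnorm_ge0 A : 0 <= sqnorm A.
Proof. by apply: sumr_ge0 => i _; rewrite -expr2 sqr_ge0. Qed.

Lemma dotf_lineR A C D t : dotf D (line A C t) = dotf D A + t * dotf D C.
Proof.
by rewrite /dotf mulr_sumr -big_split; apply: eq_bigr => i _; rewrite ffunE /=; ring.
Qed.

Lemma sqnorm_line A C t :
  sqnorm (line A C t) = sqnorm A + 2 * t * dotf A C + t ^+ 2 * sqnorm C.
Proof.
rewrite /sqnorm /dotf !mulr_sumr -!big_split.
by apply: eq_bigr => i _; rewrite ffunE /=; ring.
Qed.

(** A quadratic in [t] that is minimal at [t = 0] has no linear term, and here that term is
    [2 * t * dotf B C]. *)
Lemma line_min_orthogonal B C :
  (forall t, sqnorm B <= sqnorm (line B C t)) -> dotf B C = 0.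
Proof.
move=> Bmin; set x := dotf B C; set n := sqnorm C.
have n0 : 0 <= n by exact: sqnorm_ge0.
have n1 : 0 < n + 1 by lra.
(* Dividing by n + 1 rather than n also covers C = 0. *)
have := Bmin (- x / (n + 1)); rewrite sqnorm_line -/x -/n.
have -> : sqnorm B + 2 * (- x / (n + 1)) * x + (- x / (n + 1)) ^+ 2 * n =
  sqnorm B - (x / (n + 1)) ^+ 2 * (n + 2) by field; rewrite gt_eqF.
move=> le0; have sq0 : 0 <= (x / (n + 1)) ^+ 2 by rewrite sqr_ge0.
have {le0} /eqP : (x / (n + 1)) ^+ 2 = 0 by nra.
by rewrite sqrf_eq0 mulf_eq0 invr_eq0 (gt_eqF n1) orbF => /eqP.
Qed.

End Energy.

(** * Undirected adjacency, cycles and circulations *)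

Section Digraph.
Variables (V : finType) (E : {set V * V}).
Hypotheses (E_loopless : loopless E) (E_antiparallel_free : antiparallel_free E).
Implicit Types (S T : {set edge E}) (e g h : edge E) (c : seq V) (a b x : V).

Lemma src_neq_tgt g : src g != tgt g.
Proof.
apply/eqP => eq_st; have := valP g; rewrite [val g]surjective_pairing.
by rewrite -/(src g) -/(tgt g) eq_st (negPf (E_loopless _)).
Qed.

Lemma edge_not_antiparallel g h : val h != (tgt g, src g).
Proof.
apply/eqP => hg; have := E_antiparallel_free (src_neq_tgt g).
by rewrite -hg (valP h) -surjective_pairing (valP g).
Qed.

Lemma adj_sym S : symmetric (adj S).
Proof. by move=> a b; apply: eq_existsb => g; rewrite (orbC (_ == (a, b))). Qed.

Lemma adj_edge S g : adj S (src g) (tgt g) = (g \in S).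
Proof.
apply/existsP/idP => [[h /andP[hS]]|gS].
  rewrite (negPf (edge_not_antiparallel g h)) orbF -surjective_pairing.
  by move/eqP/val_inj => <-.
by exists g; rewrite gS -surjective_pairing eqxx.
Qed.

(** A repetition-free path in [S] from [tgt e] back to [src e] is closed up by [e]. *)
Lemma is_tree_cycle_exists S e : e \notin S -> connect (adj S) (tgt e) (src e) ->
  exists c, is_tree_cycle S e c.
Proof.
move=> eS /connectP[p0 p0P]; case: (shortenP p0P) => p pP p_uniq _ p_last.
exists (tgt e :: p).
have st := src_neq_tgt e.
have adjS : subrel (adj S) (adj (e |: S)).
  move=> a b /existsP[g /andP[gS gab]]; apply/existsP; exists g.
  by rewrite gab inE gS orbT.
split.
  split.
    (* At least three vertices: an empty [p] would make [e] a loop, and a single step would be an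
       edge of [S] joining the ends of [e], hence [e] itself. *)
    case: p pP p_last {p_uniq} => [|x [|y p]] //=; first by move=> _ /eqP; rewrite (negPf st).
    by rewrite andbT => tx xs; rewrite -xs adj_sym adj_edge (negPf eS) in tx.
  rewrite /ucycle p_uniq andbT /cycle rcons_path (sub_path adjS pP) /=.
  by rewrite -p_last adj_edge setU11.
rewrite /step p_last mem_last andTb.
case/lastP: p p_last p_uniq {pP} => [/eqP|p x]; first by rewrite (negPf st).
rewrite last_rcons -rcons_cons => <- p_uniq.
(* The step along [e] wraps around from the last entry to the first; rotating by one puts [src e] in
   front, so that [next] computes. *)
by rewrite -(next_rotr 1 p_uniq) rotr1_rcons /= eqxx.
Qed.

(** Adjacent vertices are joined by exactly one edge of [E], in one of its two orientations; the two
    sums count one orientation each. *)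
Lemma sum_incident (R : realType) S x a : adj S x a ->
  \sum_(g : edge E | tgt g == a) (x == src g)%:R +
  \sum_(g : edge E | src g == a) (x == tgt g)%:R = 1 :> R.
Proof.
have sum_val b d : \sum_(h : edge E) (val h == (b, d))%:R =
    \sum_(h : edge E | tgt h == d) (b == src h)%:R :> R.
  rewrite [RHS]big_mkcond; apply: eq_bigr => h _.
  by rewrite [val h]surjective_pairing xpair_eqE -/(src h) -/(tgt h) andbC (eq_sym b); case: eqP.
have sum_val' b d : \sum_(h : edge E) (val h == (d, b))%:R =
    \sum_(h : edge E | src h == d) (b == tgt h)%:R :> R.
  rewrite [RHS]big_mkcond; apply: eq_bigr => h _.
  by rewrite [val h]surjective_pairing xpair_eqE -/(src h) -/(tgt h) (eq_sym b); case: eqP.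
have sum1 g : \sum_(h : edge E) (val h == val g)%:R = 1 :> R.
  by rewrite (bigD1 g) //= eqxx big1 ?addr0 // => h /negPf; rewrite -val_eqE => ->.
have sum0 g : \sum_(h : edge E) (val h == (tgt g, src g))%:R = 0 :> R.
  by rewrite big1 // => h _; rewrite (negPf (edge_not_antiparallel g h)).
rewrite -sum_val -sum_val' => /existsP[g /andP[_]].
case/orP => /eqP gE; have := sum0 g; rewrite /src /tgt gE => ->;
  by rewrite -gE sum1 ?addr0 ?add0r.
Qed.

(** * The function of a cycle is a circulation *)

Section Cycle.
Variables (S : {set edge E}) (c : seq V).
Hypothesis c_cycle : undirected_cycle S c.

Lemma cycle_uniq : uniq c. Proof. by case: c_cycle => _ /andP[]. Qed.

Lemma step_adj a b : step c a b -> adj S a b.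
Proof.
case/andP=> ac /eqP <-; apply: next_cycle ac.
by case: c_cycle => _ /andP[].
Qed.

Lemma step_prev a b : step c b a = (a \in c) && (prev c a == b).
Proof.
have c_uniq := cycle_uniq.
apply/andP/andP=> -[ac /eqP <-].
  by rewrite mem_next prev_next.
by rewrite mem_prev next_prev.
Qed.

Lemma step_asym a b : step c a b -> ~~ step c b a.
Proof.
case/andP=> ac /eqP ab; apply/negP => /andP[_ /eqP ba].
case: c_cycle => c_size _; have c_uniq := cycle_uniq.
(* With [a] rotated to the front, the list begins with [a], [b] and a third vertex, which is the
   successor of [b] and differs from [a]. *)
have [i q c_rot] := rot_to ac.
rewrite -(next_rot i c_uniq) c_rot in ab; rewrite -(next_rot i c_uniq) c_rot in ba.
rewrite -(size_rot i) c_rot in c_size; rewrite -(rot_uniq i) c_rot in c_uniq.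
case: q {c_rot} c_size c_uniq ab ba => [|y [|z q]] //= _ /andP[aNyzq _].
rewrite eqxx => yb; rewrite -{}yb in aNyzq *.
by move: aNyzq; rewrite !inE !negb_or (eq_sym a y) eqxx => /and3P[/negPf-> /negPf az _] za;
  rewrite za eqxx in az.
Qed.

Variable R : realType.

(** Since the two tests exclude each other, the nested conditional is a difference of indicators,
    which can be summed term by term. *)
Lemma cycle_functionE g : cycle_function E R c g =
  (step c (src g) (tgt g))%:R - (step c (tgt g) (src g))%:R.
Proof.
rewrite ffunE; case: ifP => [st|_]; first by rewrite (negPf (step_asym st)) subr0.
by case: ifP; rewrite sub0r ?oppr0.
Qed.

(** At a vertex of the cycle, the edge shared with its predecessor contributes 1 and the one shared
    with its successor contributes -1, whatever their orientations. *)
Lemma divergence_cycle : divergence (cycle_function E R c) = 0.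
Proof.
apply/ffunP => a; rewrite !ffunE.
under eq_bigr => g /eqP ga do rewrite cycle_functionE ga (step_prev a) /step.
under [X in _ - X]eq_bigr => g /eqP ga do rewrite cycle_functionE ga (step_prev a) /step.
have [ac|_] := boolP (a \in c) => /=; last by rewrite !big1 ?subrr // => g _; rewrite subrr.
have a_prev : step c (prev c a) a by rewrite step_prev ac eqxx.
have a_next : step c a (next c a) by rewrite /step ac eqxx.
rewrite !sumrB.
have := step_adj a_next; rewrite adj_sym => /(sum_incident R).
have := sum_incident R (step_adj a_prev).
by move=> *; lra.
Qed.

End Cycle.

(* Removing a tree edge e disconnects its endpoints; summing the divergence over
   the component of src e leaves only the term Y e. *)
Lemma circulation_tree0 (R : realType) T (Y : {ffun edge E -> R}) :
    (forall c, ~ undirected_cycle T c) -> (forall g, g \notin T -> Y g = 0) ->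
  divergence Y = 0 -> forall g, Y g = 0.
Proof.
move=> T_acyclic Y_supp Y_div e; have [eT|/Y_supp//] := boolP (e \in T).
set r := adj (T :\ e).
have r_sym : connect_sym r by apply: sym_connect_sym; exact: adj_sym.
(* Otherwise [e] would close a path in [T :\ e] into a cycle of [T]. *)
have cut : ~~ connect r (src e) (tgt e).
  rewrite r_sym; apply/negP => /is_tree_cycle_exists[|c [c_cycle _]]; first by rewrite !inE eqxx.
  by rewrite setD1K // in c_cycle; exact: T_acyclic c_cycle.
have : \sum_(a | connect r (src e) a) divergence Y a = 0.
  by rewrite Y_div big1 // => a _; rewrite ffunE.
under eq_bigr do rewrite ffunE.
rewrite sumrB.
have fiber (h : edge E -> V) : \sum_(a | connect r (src e) a) \sum_(g | h g == a) Y g =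
    \sum_(g | connect r (src e) (h g)) Y g.
  rewrite [RHS](partition_big h (connect r (src e))) //.
  apply: eq_bigr => a ra; apply: eq_bigl => g; by case: eqP => [->|]; rewrite ?ra ?andbF.
rewrite !fiber [X in _ - X](bigD1 e) /=; last exact: connect0.
(* An edge of [T] other than [e] has both ends in the component or neither, so its inflow and
   outflow terms cancel. *)
suff -> : \sum_(g | connect r (src e) (tgt g)) Y g =
    \sum_(g | connect r (src e) (src g) && (g != e)) Y g by move=> ?; lra.
rewrite big_mkcond [RHS]big_mkcond; apply: eq_bigr => g _.
have [->|ge] := eqVneq g e; first by rewrite (negPf cut) andbF.
have [gT|/Y_supp->] := boolP (g \in T); last by rewrite !if_same.
have r_g : r (src g) (tgt g) by rewrite /r adj_edge !inE ge.
by rewrite andbT (same_connect1r r_sym r_g).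
Qed.

Lemma divergence_line (R : realType) (A C : {ffun edge E -> R}) t :
  divergence (line A C t) = line (divergence A) (divergence C) t.
Proof.
apply/ffunP => a; rewrite !ffunE.
under eq_bigr do rewrite ffunE.
under [X in _ - X]eq_bigr do rewrite ffunE.
by rewrite !big_split -!mulr_sumr /=; ring.
Qed.

Lemma divergence_sum (R : realType) (P : pred (edge E)) (k : edge E -> R)
    (F : edge E -> {ffun edge E -> R}) :
  (forall e, P e -> divergence (F e) = 0) ->
  divergence [ffun g => \sum_(e | P e) k e * F e g] = 0.
Proof.
move=> F_div; apply/ffunP => a; rewrite !ffunE.
under eq_bigr do rewrite ffunE.
under [X in _ - X]eq_bigr do rewrite ffunE.
rewrite exchange_big [X in _ - X]exchange_big -sumrB big1 //= => e /F_div/ffunP/(_ a).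
by rewrite !ffunE -!mulr_sumr -mulrBr => ->; rewrite mulr0.
Qed.

(** * Tree cycles span the circulations *)

Section TreeCycle.
Variables (T : {set edge E}) (R : realType).
Hypothesis T_tree : spanning_tree T.

Lemma tree_cycleP e : e \notin T -> is_tree_cycle T e (tree_cycle T e).
Proof.
move=> eT; apply: (@xgetPex _ [::] (is_tree_cycle T e)).
exact: is_tree_cycle_exists (T_tree.1 _ _).
Qed.

Lemma divergence_tree_cycle e : e \notin T -> divergence (tree_cycle_function R T e) = 0.
Proof. by case/tree_cycleP => c_cyc _; exact: (divergence_cycle c_cyc R). Qed.

(** The cycle of [e] uses only edges of [e |: T] and traverses [e] forwards. Off the tree, the cycle
    functions are thus dual to the coordinates, which identifies the coefficients of a
    circulation. *)
Lemma tree_cycle_off_tree e g : e \notin T -> g \notin T ->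
  tree_cycle_function R T e g = (g == e)%:R.
Proof.
move=> eT gT; have [c_cyc c_step] := tree_cycleP eT.
rewrite /tree_cycle_function (cycle_functionE c_cyc).
have [->|ge] := eqVneq g e; first by rewrite c_step (negPf (step_asym c_cyc c_step)) subr0.
have adj0 : adj (e |: T) (src g) (tgt g) = false.
  by rewrite adj_edge !inE (negPf ge) (negPf gT).
case: (boolP (step _ (src g) _)) => [/(step_adj c_cyc)|_]; first by rewrite adj0.
case: (boolP (step _ (tgt g) _)) => [/(step_adj c_cyc)|_]; last by rewrite subrr.
by rewrite adj_sym adj0.
Qed.

Lemma circulation_decomposition (X : {ffun edge E -> R}) : divergence X = 0 ->
  X = [ffun g => \sum_(e | e \notin T) X e * tree_cycle_function R T e g].
Proof.
move=> X_div; set Z := RHS; apply/ffunP => g.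
suff : line X Z (-1) g = 0 by rewrite ffunE => ?; lra.
apply: (circulation_tree0 T_tree.2) => [h hT|].
  rewrite !ffunE (bigD1 h) //= tree_cycle_off_tree // eqxx mulr1 big1 ?addr0; first by ring.
  by move=> e /andP[eT eh]; rewrite tree_cycle_off_tree // eq_sym (negPf eh) mulr0.
rewrite divergence_line X_div divergence_sum; last exact: divergence_tree_cycle.
by apply/ffunP => a; rewrite !ffunE mulr0 addr0.
Qed.

Lemma sqnorm_tree_cycle_gt0 e : e \notin T -> 0 < sqnorm (tree_cycle_function R T e).
Proof.
move=> eT; rewrite /sqnorm /dotf (bigD1 e) //= tree_cycle_off_tree // eqxx mulr1.
by rewrite ltr_wpDr // sumr_ge0 // => g _; rewrite -expr2 sqr_ge0.
Qed.

Lemma sqnorm_circulation_le (X : {ffun edge E -> R}) : divergence X = 0 ->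
  sqnorm X <= \sum_(e | e \notin T) dotf X (tree_cycle_function R T e) ^+ 2.
Proof.
move=> X_div; set d := fun e => dotf X (tree_cycle_function R T e).
have XE : sqnorm X = \sum_(e | e \notin T) X e * d e.
  rewrite /sqnorm {2}(circulation_decomposition X_div) /dotf.
  under eq_bigr do rewrite ffunE mulr_sumr.
  rewrite exchange_big; apply: eq_bigr => e _; rewrite mulr_sumr.
  by apply: eq_bigr => g _; ring.
(* Only the squares on tree edges are dropped. *)
have Xsub : \sum_(e | e \notin T) X e ^+ 2 <= sqnorm X.
  rewrite /sqnorm /dotf [leRHS](bigID (mem T)) /= ler_wpDl //.
  by apply: sumr_ge0 => g _; rewrite -expr2 sqr_ge0.
have : 0 <= \sum_(e | e \notin T) (d e - X e) ^+ 2.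
  by apply: sumr_ge0 => e _; rewrite sqr_ge0.
have sqE e : (d e - X e) ^+ 2 = d e ^+ 2 + X e ^+ 2 - 2 * (X e * d e) by ring.
under eq_bigr do rewrite sqE.
by rewrite sumrB big_split /= -mulr_sumr -XE => ?; lra.
Qed.

End TreeCycle.

(** Moving from [B] along a circulation preserves the constraint, so [B] is minimal on that line. *)
Lemma minimizer_orthogonal (R : realType) f (B C : {ffun edge E -> R}) :
  energy_minimizer f B -> divergence C = 0 -> dotf B C = 0.
Proof.
case=> B_div B_min C_div; apply: line_min_orthogonal => t; apply: B_min.
by rewrite divergence_line C_div B_div; apply/ffunP => a; rewrite !ffunE mulr0 addr0.
Qed.

End Digraph.

Theorem theorem10 (R : realType) (V : finType) (E : {set V * V})
    (E_loopless : loopless E) (E_antiparallel_free : antiparallel_free E)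
    (E_connected : undirected_connected [set: edge E])
    (f : {ffun V -> R}) (f_sum0 : \sum_a f a = 0)
    (B : {ffun edge E -> R}) (B_min : energy_minimizer f B)
    (T : {set edge E}) (T_tree : spanning_tree T) (T_proper : ~: T != set0)
    (A : {ffun edge E -> R}) (A_div : divergence A = f) :
  expectation (cycle_prob R T)
      (fun e => energy_gap B (cycle_update A (tree_cycle_function R T e)))
    <= (1 - 1 / tau R T) * energy_gap B A.
Proof.
set C := tree_cycle_function R T; set X := line A B (-1).
have X_div : divergence X = 0.
  rewrite divergence_line A_div B_min.1.
  by apply/ffunP => a; rewrite !ffunE; ring.
have AE : A = line B X 1 by apply/ffunP => g; rewrite !ffunE; ring.
have gapE : energy_gap B A = sqnorm X.
  rewrite /energy_gap /energy {1}AE sqnorm_line (minimizer_orthogonal B_min X_div).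
  by ring.
have C_gt0 e : e \notin T -> 0 < sqnorm (C e).
  exact: (sqnorm_tree_cycle_gt0 E_loopless E_antiparallel_free R T_tree).
have tau_gt0 : 0 < tau R T.
  (* One edge outside [T] suffices, since its cycle function has positive norm. *)
  have [e0] := set0Pn _ T_proper; rewrite inE => e0T.
  rewrite /tau (bigD1 e0) //= ltr_wpDr ?C_gt0 // sumr_ge0 // => e _.
  exact: sqnorm_ge0.
have dotAC e : e \notin T -> dotf A (C e) = dotf X (C e).
  move=> eT; have C_div : divergence (C e) = 0.
    exact: (divergence_tree_cycle E_loopless E_antiparallel_free R T_tree eT).
  rewrite {1}AE /dotf; under eq_bigr do rewrite mulrC.
  rewrite -/(dotf (C e) (line B X 1)) dotf_lineR mul1r.
  have dotC D : dotf (C e) D = dotf D (C e) by apply: eq_bigr => g _; rewrite mulrC.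
  by rewrite !dotC (minimizer_orthogonal B_min C_div) add0r.
have -> : expectation (cycle_prob R T) (fun e => energy_gap B (cycle_update A (C e))) =
    energy_gap B A - (\sum_(e | e \notin T) dotf X (C e) ^+ 2) / tau R T.
  (* The update lowers the gap by [dotf X (C e) ^+ 2 / sqnorm (C e)]; the weight
     [sqnorm (C e) / tau R T] cancels this denominator. *)
  transitivity (\sum_(e | e \notin T)
      (sqnorm (C e) * (energy_gap B A / tau R T) - dotf X (C e) ^+ 2 / tau R T)).
    rewrite [RHS]big_mkcond; apply: eq_bigr => e _; rewrite /cycle_prob.
    case: ifP => eT; last by rewrite mul0r.
    rewrite /energy_gap /energy -/(line A (C e) (alpha_star A (C e))) sqnorm_line.
    rewrite /alpha_star dotAC // -/(C e).
    by field; rewrite !gt_eqF ?C_gt0.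
  (* The norms sum to [tau R T], so the weights sum to 1 and the first term is the old gap. *)
  rewrite sumrB -!mulr_suml -/(tau R T).
  by rewrite mulrCA divff ?mulr1 // gt_eqF.
rewrite mulrBl mul1r mul1r lerD2l lerN2 [leLHS]mulrC ler_pM2r ?invr_gt0 // gapE.
exact: sqnorm_circulation_le.
Qed.
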